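(* Let $0<p<1$ and let $\{X_n;\,n\ge1\}$ be a sequence of independent copies of a $\mathbf{B}$-valued random variable $X$, with $S_n=\sum_{k=1}^n X_k$. Then \[ \sum_{n=1}^{\infty}\frac1n\left(\frac{\|S_n\|}{n^{1/p}}\right)<\infty\ \text{ almost surely} \quad\text{if and only if}\quad \mathbb{E}\|X\|^p<\infty . \] Furthermore, \[ \sum_{n=1}^{\infty}\frac1n\left(\frac{\mathbb{E}\|S_n\|}{n^{1/p}}\right)<\infty \quad\text{if and only if}\quad \mathbb{E}\|X\|<\infty . \]
   Context: $(\mathbf{B},\|\cdot\|)$ is a real separable Banach space with its Borel $\sigma$-algebra. *)

(* Defs.v *)
From HB Require Import structures.
From mathcomp Require Import all_boot all_order all_algebra.
From mathcomp Require Import finmap all_classical all_reals all_analysis.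
Set Implicit Arguments. Unset Strict Implicit. Unset Printing Implicit Defensive.
Import Order.TTheory GRing.Theory Num.Theory.
Local Open Scope classical_set_scope.
Local Open Scope ring_scope.

Definition borel_set (T : topologicalType) (A : set T) : Prop :=
  <<s [set U : set T | open U] >> A.

Definition separable (T : topologicalType) : Prop :=
  exists D : set T, countable D /\ dense D.

Definition borel_rv {d} (Omega : measurableType d) (T : topologicalType)
  (X : Omega -> T) : Prop :=
  forall A : set T, borel_set A -> measurable (X @^-1` A).

Definition mutually_independent {d} {R : realType} (Omega : measurableType d)
  (P : probability Omega R) (T : topologicalType) (X : nat -> Omega -> T) : Prop :=
  forall (I : {fset nat}) (A : nat -> set T),
    (forall i, i \in I -> borel_set (A i)) ->
    P (\bigcap_(i in [set` I]) (X i @^-1` A i)) =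
    (\prod_(i <- I) P (X i @^-1` A i))%E.

Definition same_distribution {d} {R : realType} (Omega : measurableType d)
  (P : probability Omega R) (T : topologicalType) (X Y : Omega -> T) : Prop :=
  forall A : set T, borel_set A -> P (X @^-1` A) = P (Y @^-1` A).

Definition iid_copies {d} {R : realType} (Omega : measurableType d)
  (P : probability Omega R) (T : topologicalType) (X : Omega -> T)
  (Xs : nat -> Omega -> T) : Prop :=
  borel_rv X /\ (forall n, borel_rv (Xs n)) /\
  mutually_independent P Xs /\ (forall n, same_distribution P (Xs n) X).

(* Partial sums S_n = X_1 + ... + X_n, with the sequence indexed from 0:
   S n w = \sum_(k < n) Xs k w. *)
Definition partial_sum {R : realType} {Omega : Type} (B : normedModType R)
  (Xs : nat -> Omega -> B) (n : nat) (w : Omega) : B :=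
  \sum_(k < n) Xs k w.

(* Main.v *)
Require Import Defs.
From HB Require Import structures.
From mathcomp Require Import all_boot all_order all_algebra finmap.
From mathcomp Require Import all_classical all_reals all_analysis measurable_realfun.
From mathcomp Require Import ring lra zify.
Set Implicit Arguments. Unset Strict Implicit. Unset Printing Implicit Defensive.
Import Order.TTheory GRing.Theory Num.Theory.
Import numFieldNormedType.Exports.
Local Open Scope classical_set_scope.
Local Open Scope ring_scope.

(** Write [q = 1/p > 1].  If [E|X|^p] is finite, then
    [sum_k min(|X_k| / k^q, 1)] has expectation at most [C E|X|^p], so
    [sum_k |X_k| / k^q] converges almost surely; bounding [|S_n|] by the sum of
    the [|X_k|] and summing by parts gives the series of the theorem.

    Conversely, convergence of the series forces
    [Q_n = n^(-1-q) sum_(n <= j < 3n) |S_j|] to tend to 0 almost surely.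
    Averaging over starting points [k] in [[n, 2n)] and using stationarity of
    the increments, the path [S_(n+i) - S_n], [i < n], is of average size at
    most [n^q / 2] with probability at least 1/2.  If [n] is the first time after
    [N] at which [|S_n| > n^q], these increments are independent of the past,
    and when they are small [Q_n >= 1/2].  Hence the probability that
    [|S_n| > n^q] for some [n >= N] is at most twice that of [Q_n > 1/16] for
    some [n >= N], and tends to 0.  Then [|X_n| <= 2 (n+1)^q] for all [n >= N] with
    probability at least 1/2, and independence turns this into
    [sum_n P(|X| > 2 (n+1)^q) < oo], that is [E|X|^p < oo].

    For the series of means, the first term is [E|X|], and [E|S_n| <= n E|X|]. *)

(** * Real series *)

(** Bernoulli's inequality [(1 - 1/(n+2))^(-s) >= 1 + s/(n+2)], obtained from [ln (1 + x) <= x] and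
    [1 + x <= exp x]. It replaces the comparison of [sum n^(-1-s)] with an integral. *)
Lemma powRV_telescope (R : realType) (s : R) (n : nat) : 0 < s ->
  s * (n.+2%:R^-1 * (n.+2%:R `^ s)^-1) <= (n.+1%:R `^ s)^-1 - (n.+2%:R `^ s)^-1.
Proof.
move=> s0.
have n1 : (0 : R) < n.+1%:R by rewrite ltr0n.
have n2 : (0 : R) < n.+2%:R by rewrite ltr0n.
have b0 : 0 < (n.+2%:R `^ s)^-1 by rewrite invr_gt0 powR_gt0.
suff h : 1 + s * n.+2%:R^-1 <= (n.+1%:R `^ s)^-1 * n.+2%:R `^ s.
  have := ler_wpM2r (ltW b0) h; rewrite mulfK ?gt_eqF ?powR_gt0//.
  move=> h1; apply: le_trans (lerB h1 (lexx _)).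
  by rewrite le_eqVlt; apply/orP; left; apply/eqP; ring.
have -> : (n.+1%:R `^ s)^-1 * n.+2%:R `^ s = (n.+1%:R / n.+2%:R) `^ (- s) :> R.
  rewrite powRN powRM ?invr_ge0 ?ler0n// invfM -!powR_inv1 ?ltW ?powR_ge0//.
  by rewrite -!powRrM; congr (_ * _ `^ _); ring.
have r0 : (0 : R) < n.+1%:R / n.+2%:R by rewrite divr_gt0.
rewrite /powR gt_eqF//.
have h : ln (n.+1%:R / n.+2%:R) <= - (n.+2%:R^-1) :> R.
  have -> : n.+1%:R / n.+2%:R = 1 + - (n.+2%:R^-1) :> R.
    by rewrite -(natr1 n.+1); field; rewrite gt_eqF// natr1.
  apply: le_ln1Dx; rewrite ltrN2 invf_lt1//.
  by rewrite ltr1n.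
apply: le_trans (expR_ge1Dx _).
by rewrite lerD2l mulNr -mulrN ler_pM2l// lerNr.
Qed.

(** Summation by parts, run as an induction on [M]. The subtracted boundary term pays for the old
    partial sum in each new term: its weight drops from [M^-q] to [(M+1)^-q], and [powRV_telescope]
    bounds this drop from below. *)
Lemma sum_weighted_partial_sums_le (R : realType) (a : nat -> R) (q : R) (M : nat) :
  0 < q -> (forall k, 0 <= a k) ->
  \sum_(1 <= n < M.+1) n%:R^-1 * ((\sum_(k < n) a k) / n%:R `^ q) <=
  (1 + q^-1) * (\sum_(k < M) a k / k.+1%:R `^ q)
    - q^-1 * ((\sum_(k < M) a k) / M%:R `^ q).
Proof.
move=> q0 a0; elim: M => [|M IH].
  by rewrite big_geq// !big_ord0 !(mulr0, mul0r) subr0.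
rewrite big_nat_recr//= !big_ord_recr/=.
have s0 : 0 <= \sum_(k < M) a k by apply: sumr_ge0.
have qi : 0 < q^-1 by rewrite invr_gt0.
have b0 : 0 < (M.+1%:R `^ q)^-1 :> R by rewrite invr_gt0 powR_gt0.
have h1 : M.+1%:R^-1 <= 1 :> R by rewrite invf_le1 ?ler1n ?ltr0n.
have h0 : 0 < M.+1%:R^-1 :> R by rewrite invr_gt0.
have key : (\sum_(k < M) a k) * (M.+1%:R^-1 * (M.+1%:R `^ q)^-1) <=
   q^-1 * ((\sum_(k < M) a k) * ((M%:R `^ q)^-1 - (M.+1%:R `^ q)^-1)).
  (* At [M = 0] the partial sum is empty, so the weight with base 0 is multiplied by 0. *)
  case: M s0 {IH b0 h1 h0} => [|M] s0; first by rewrite big_ord0 !(mul0r, mulr0).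
  rewrite [leRHS]mulrCA ler_wpM2l// ler_pdivlMl//.
  exact: powRV_telescope.
have ha : a M * (M.+1%:R^-1 * (M.+1%:R `^ q)^-1) <= a M * (M.+1%:R `^ q)^-1.
  by apply: ler_wpM2l => //; rewrite ger_pMl.
move: IH key ha.
set S := \sum_(k < M) a k.
set T := \sum_(k < M) a k / _.
set U := \sum_(1 <= n < M.+1) _.
set x := (M.+1%:R `^ q)^-1; set y := (M%:R `^ q)^-1; set z := M.+1%:R^-1.
move=> IH key ha.
have e1 : z * ((S + a M) * x) = S * (z * x) + a M * (z * x) by ring.
rewrite e1.
lra.
Qed.

(** With [y = x^p], the terms with [k + 1 <= y] are at most 1 and number at most [y]; beyond them,
    [x / (k+1)^q] telescopes with exponent [s = q - 1]. *)
Lemma sum_min_powR_le (R : realType) (p x : R) (M : nat) : 0 < p < 1 -> 0 <= x ->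
  \sum_(k < M) Num.min (x / k.+1%:R `^ p^-1) 1 <= (2 + (p^-1 - 1)^-1) * x `^ p.
Proof.
move=> /andP[p0 p1] x0; set q := p^-1; set s := q - 1.
have q1 : 1 < q by rewrite /q invf_gt1.
have s0 : 0 < s by rewrite subr_gt0.
have si : 0 < s^-1 by rewrite invr_gt0.
set y := x `^ p.
have y0 : 0 <= y by exact: powR_ge0.
have xy : x = y `^ q by rewrite /y -powRrM /q divff ?gt_eqF// powRr1.
have qE (n : nat) : n.+1%:R `^ q = n.+1%:R * n.+1%:R `^ s :> R.
  by rewrite -[in RHS](powRr1 (ler0n _ n.+1)) -powRrM mul1r -powRD ?pnatr_eq0 ?implybT//; congr (_ `^ _); rewrite /s; lra.
(* The induction needs the two regimes apart and, in the second, a boundary term that is dropped at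
   the end. *)
suff : if M%:R <= y then \sum_(k < M) Num.min (x / k.+1%:R `^ q) 1 <= M%:R
  else \sum_(k < M) Num.min (x / k.+1%:R `^ q) 1 <= (2 + s^-1) * y - s^-1 * (x / M%:R `^ s).
  have h : 0 <= s^-1 * y by rewrite mulr_ge0// ltW.
  case: ifPn => [My h1|_ h1]; first by apply: le_trans h1 _; lra.
  apply: le_trans h1 _; rewrite gerBl//.
  by rewrite mulr_ge0 ?divr_ge0 ?powR_ge0// ltW.
have le1 k : Num.min (x / k.+1%:R `^ q) 1 <= 1 by rewrite ge_min lexx orbT.
have lex k : Num.min (x / k.+1%:R `^ q) 1 <= x / k.+1%:R `^ q by rewrite ge_min lexx.
elim: M => [|M IH]; first by rewrite y0 big_ord0.
rewrite big_ord_recr/=.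
have M0 : (0 : R) < M.+1%:R by rewrite ltr0n.
case: ifPn => My1.
  have My : M%:R <= y by apply: le_trans My1; rewrite ler_nat.
  by move: IH; rewrite My => IH; rewrite -[leRHS]natr1 lerD.
rewrite -ltNge in My1.
(* The first case is the crossing [M <= y < M + 1]: the earlier terms together, and the new one, are
   each at most [y], hence the constant 2; [s^-1 * y] covers the boundary term. *)
move: IH; case: ifPn => My IH.
  have xs : x / M.+1%:R `^ s <= y.
    have [yE|yn0] := eqVneq y 0.
      by rewrite xy yE powR0 ?mul0r// gt_eqF// (lt_trans ltr01).
    have yp : 0 < y by rewrite lt_neqAle eq_sym yn0.
    have -> : x = y * y `^ s.
      rewrite xy -[in RHS](powRr1 y0) -powRrM mul1r -powRD ?yn0 ?implybT//.
      by congr (_ `^ _); rewrite /s; lra.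
    rewrite -mulrA ger_pMr// ler_pdivrMr ?powR_gt0// mul1r.
    by apply: ge0_ler_powR; rewrite ?nnegrE ltW.
  have xq : x / M.+1%:R `^ q <= y.
    rewrite qE invfM mulrCA; apply: le_trans xs; apply: ler_piMl.
      by rewrite divr_ge0 ?powR_ge0.
    by rewrite invf_le1 ?ler1n ?ltr0n.
  have := lex M.
  have : s^-1 * (x / M.+1%:R `^ s) <= s^-1 * y by rewrite ler_pM2l.
  lra.
case: M My IH My1 le1 lex M0 => [|M] My IH _ _ lex _; first by rewrite y0 in My.
have h : x * (M.+2%:R `^ q)^-1 <= s^-1 * (x * ((M.+1%:R `^ s)^-1 - (M.+2%:R `^ s)^-1)).
  rewrite [leRHS]mulrCA ler_wpM2l// ler_pdivlMl// qE invfM.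
  exact: powRV_telescope.
have := lex M.+1.
rewrite mulrBr mulrBr in h.
move: IH h.
set S := \sum_(k < M.+1) _.
lra.
Qed.

Lemma nneseries_ltyP (R : realType) (u : nat -> R) (m : nat) :
  (forall n, 0 <= u n) ->
  ((\sum_(m <= n <oo) (u n)%:E < +oo)%E <->
   exists C : R, forall M, \sum_(m <= n < M) u n <= C).
Proof.
move=> u0; have u0' n : (m <= n)%N -> true -> (0 <= (u n)%:E)%E by rewrite lee_fin.
split=> [h|[C hC]].
  exists (fine (\sum_(m <= n <oo) (u n)%:E)) => M.
  rewrite -lee_fin fineK ?ge0_fin_numE ?nneseries_ge0//.
  by rewrite -sumEFin; exact: nneseries_lim_ge.
apply: (@le_lt_trans _ _ C%:E); last exact: ltry.
apply: lime_le; first exact: is_cvg_nneseries.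
by apply: nearW => M; rewrite sumEFin lee_fin.
Qed.

(** The terms of a convergent series tend to 0, so from some [N] on [min (b k) 1 < 1] and the
    minimum is [b k] itself. *)
Lemma bounded_partial_sums_of_min1 (R : realType) (b : nat -> R) :
  (forall k, 0 <= b k) ->
  (\sum_(0 <= k <oo) (Num.min (b k) 1)%:E < +oo)%E ->
  exists C : R, forall M, \sum_(0 <= k < M) b k <= C.
Proof.
move=> b0 h.
have m0 k : 0 <= Num.min (b k) 1 by rewrite le_min b0 ler01.
have [C hC] := (nneseries_ltyP 0 m0).1 h.
have cv : series (fun k => Num.min (b k) 1) @ \oo --> sup (range (series (fun k => Num.min (b k) 1))).
  apply: nondecreasing_cvgn.
    apply/nondecreasing_seqP => n; rewrite /series/= big_nat_recr//= lerDl//.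
  by exists C => _ [M _ <-]; exact: hC.
have /cvgrPdist_lt /(_ _ ltr01) [N _ hN] := cvg_series_cvg_0 (cvgP _ cv).
exists (\sum_(0 <= k < N) b k + C) => M.
have [MN|NM] := leqP M N.
  rewrite (big_cat_nat _ MN)//= -addrA lerDl addr_ge0//.
    by apply: sumr_ge0.
  by apply: le_trans (hC 0%N); rewrite big_geq.
rewrite (big_cat_nat _ (ltnW NM))//= lerD2l.
apply: le_trans (hC M); rewrite [leRHS](big_cat_nat _ (ltnW NM))//=.
apply: ler_wpDl; first by apply: sumr_ge0.
rewrite !big_nat ler_sum// => k /andP[Nk _].
have := hN k Nk; rewrite /= sub0r normrN ger0_norm// => lt1.
by move: lt1; rewrite gt_min ltxx orbF le_min lexx => /ltW.
Qed.

(** The Cauchy criterion, later applied to the blocks [[n, 3n)]. *)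
Lemma bounded_partial_sums_tail (R : realType) (u : nat -> R) (m : nat) :
  (forall n, 0 <= u n) -> (exists C : R, forall M, \sum_(m <= n < M) u n <= C) ->
  forall e : R, 0 < e -> exists N, forall n l, (N <= n)%N -> (n <= l)%N ->
    \sum_(n <= j < l) u j <= e.
Proof.
move=> u0 [C hC] e e0.
pose v n := \sum_(m <= j < m + n) u j.
have cv : v @ \oo --> sup (range v).
  apply: nondecreasing_cvgn.
    by apply/nondecreasing_seqP => n; rewrite /v addnS big_nat_recr ?leq_addr//= lerDl.
  by exists C => _ [M _ <-]; exact: hC.
have e2 : 0 < e / 2 by rewrite divr_gt0.
have /cvgrPdist_lt /(_ _ e2) [N _ hN] := cv.
exists (m + N)%N => n l Nn nl.
have h1 := hN (n - m)%N; have h2 := hN (l - m)%N.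
rewrite /= /v !subnKC in h1 h2; try lia.
have {}h1 := h1 ltac:(rewrite /=; lia); have {}h2 := h2 ltac:(rewrite /=; lia).
have : \sum_(m <= j < l) u j = \sum_(m <= j < n) u j + \sum_(n <= j < l) u j.
  by rewrite (big_cat_nat _ nl)//=; lia.
move: h1 h2; rewrite !ltr_norml => /andP[? ?] /andP[? ?]; lra.
Qed.

(** * Sums over blocks of indices *)

Lemma ler_sum_nat_widen (R : realType) (a : nat -> R) (m n k l : nat) :
  (forall j, 0 <= a j) -> (m <= k)%N -> (l <= n)%N ->
  \sum_(k <= j < l) a j <= \sum_(m <= j < n) a j.
Proof.
move=> a0 mk ln; have [kl|lk] := leqP k l; last first.
  by rewrite [leLHS]big_geq ?sumr_ge0// ltnW.
rewrite (big_cat_nat mk (leq_trans kl ln))/= (big_cat_nat kl ln)/= addrCA.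
by rewrite lerDl addr_ge0 ?sumr_ge0.
Qed.

Lemma sum_ord_shift (R : realType) (a : nat -> R) (k n : nat) :
  \sum_(i < n) a (k + i)%N = \sum_(k <= j < k + n) a j.
Proof.
rewrite -[X in index_iota X _](add0n k) big_addn addKn big_mkord.
by apply: eq_bigr => i _; rewrite addnC.
Qed.

(** Markov's inequality at each starting point [k]; [a j] stands for [|S_j|] and [t k i] for
    [|S_(k+i) - S_k|]. Each window [[k, k+n)] lies in [[n, 3n)], and summing [T + n * a k] over the
    [n] values of [k] gives at most [2 n T]. *)
Lemma count_large_increments_le (R : realType) (a : nat -> R)
    (t : nat -> nat -> R) (n : nat) (c : R) :
  (0 < n)%N -> 0 < c -> (forall k, 0 <= a k) ->
  (forall k i, t k i <= a (k + i)%N + a k) ->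
  \sum_(n <= k < n + n) (n%:R * c / 2 < \sum_(i < n) t k i)%R%:R <=
  4 * (\sum_(n <= j < n + n + n) a j) / c.
Proof.
move=> n0 c0 a0 tle.
have nr : 0 < n%:R :> R by rewrite ltr0n.
set T := \sum_(n <= j < n + n + n) a j.
have T0 : 0 <= T by apply: sumr_ge0.
have step k : (n <= k < n + n)%N ->
  (n%:R * c / 2 < \sum_(i < n) t k i)%R%:R <= 2 / (n%:R * c) * (T + n%:R * a k).
  move=> /andP[nk kn].
  have hT : \sum_(i < n) a (k + i)%N <= T.
    rewrite sum_ord_shift; apply: ler_sum_nat_widen => //; lia.
  have ht : \sum_(i < n) t k i <= T + n%:R * a k.
    apply: (@le_trans _ _ (\sum_(i < n) (a (k + i)%N + a k))); first exact: ler_sum.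
    by rewrite big_split/= sumr_const card_ord -[a k *+ n]mulr_natl lerD2r.
  case: ltP => [lt|_]; last first.
    apply: mulr_ge0; first by rewrite divr_ge0// ltW// mulr_gt0.
    by apply: addr_ge0 => //; rewrite mulr_ge0// ltW.
  rewrite /= -invf_div ler_pdivlMl ?mulr1; last by rewrite divr_gt0// mulr_gt0.
  by apply: ltW; apply: lt_le_trans lt ht.
rewrite big_nat; apply: le_trans (ler_sum _ step) _; rewrite -big_nat -mulr_sumr big_split/=.
rewrite sumr_const_nat addKn -[T *+ n]mulr_natl -mulr_sumr -mulrDr.
have hT2 : \sum_(n <= k < n + n) a k <= T.
  by apply: ler_sum_nat_widen => //; lia.
have -> : 2 / (n%:R * c) * (n%:R * (T + \sum_(n <= k < n + n) a k))
        = 2 * (T + \sum_(n <= k < n + n) a k) / c.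
  by field; rewrite !gt_eqF.
rewrite ler_pM2r ?invr_gt0//; lra.
Qed.

(** A path of height at least [c] at time [n] that then moves by at most [c / 2] on average keeps an
    average height of at least [c / 2]. *)
Lemma block_sum_ge_of_small_increments (R : realType) (a : nat -> R)
    (t : nat -> R) (n : nat) (c : R) :
  (forall k, 0 <= a k) -> (forall i, a n <= a (n + i)%N + t i) -> c <= a n ->
  \sum_(i < n) t i <= n%:R * c / 2 ->
  n%:R * c / 2 <= \sum_(n <= j < n + n + n) a j.
Proof.
move=> a0 ale can tle.
have h : n%:R * c <= \sum_(i < n) a (n + i)%N + \sum_(i < n) t i.
  rewrite -big_split/=; apply: (@le_trans _ _ (\sum_(i < n) c)).
    by rewrite sumr_const card_ord mulr_natl.
  by apply: ler_sum => i _; apply: le_trans (ale _).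
have : \sum_(i < n) a (n + i)%N <= \sum_(n <= j < n + n + n) a j.
  rewrite sum_ord_shift; apply: ler_sum_nat_widen => //; lia.
lra.
Qed.

(** * Borel random variables *)

(** A type for the Borel sigma-algebra, so that measurable functions and image measures can be used
    with values in [T]. *)
Definition borel (T : ptopologicalType) := g_sigma_algebraType [set U : set T | open U].

Section borel_rv_theory.
Context {d : measure_display} {Omega : measurableType d}.

Lemma borel_rv_open (T : topologicalType) (X : Omega -> T) :
  (forall U, open U -> measurable (X @^-1` U)) -> borel_rv X.
Proof.
move=> mX; suff : <<s [set U : set T | open U] >> `<=` [set A | measurable (X @^-1` A)] by [].
apply: smallest_sub => [|U oU]; last exact: mX.
split => /=; first by rewrite preimage_set0; exact: measurable0.
- by move=> B mB; rewrite setTD preimage_setC; exact: measurableC.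
- by move=> F mF; rewrite preimage_bigcup; exact: bigcupT_measurable.
Qed.

Lemma borel_rv_measurable (T : ptopologicalType) (X : Omega -> T) :
  borel_rv X -> measurable_fun setT (X : Omega -> borel T).
Proof. by move=> mX _ A mA; rewrite setTI; exact: mX. Qed.

Lemma borel_rv_continuous (T U : topologicalType) (f : T -> U) (X : Omega -> T) :
  continuous f -> borel_rv X -> borel_rv (f \o X).
Proof.
move=> cf mX; apply: borel_rv_open => V oV; rewrite comp_preimage.
apply: mX; apply: sub_sigma_algebra.
by apply: open_comp => // x _; exact: cf.
Qed.

Lemma borel_rv_real (R : realType) (f : Omega -> R) :
  borel_rv f -> measurable_fun setT f.
Proof.
move=> mf; apply: (measurability (@RGenOInfty.G R)); first exact: RGenOInfty.measurableE.
move=> _ [_ [x ->] <-]; rewrite setTI; apply: mf; apply: sub_sigma_algebra.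
exact: interval_open.
Qed.

Lemma borel_rv_norm (R : realType) (B : normedModType R) (X : Omega -> B) :
  borel_rv X -> measurable_fun setT (fun w => `|X w|).
Proof.
move=> mX; apply: borel_rv_real; apply: (@borel_rv_continuous B R (fun x : B => `|x|) X _ mX).
exact: norm_continuous.
Qed.

(** The enumeration may repeat values or leave [D], so finite and empty sets need no separate
    case. *)
Lemma countable_enum (T : pointedType) (D : set T) :
  countable D -> exists e : nat -> T, forall a, D a -> exists n, e n = a.
Proof.
move=> /countable_injP[f finj]; exists (fun n => get [set a | D a /\ f a = n]) => a Da.
exists (f a); have [] : [set b | D b /\ f b = f a] (get [set b | D b /\ f b = f a]).
  exact: (@getI _ [set b | D b /\ f b = f a] a).
by move=> Dg fE; apply: finj; rewrite ?inE.
Qed.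

(** Separability makes [X + Y \in U] a countable union of events that confine [X] and [Y] to balls
    centred at points of a dense sequence. *)
Lemma borel_rvD (R : realType) (B : normedModType R) (X Y : Omega -> B) :
  separable B -> borel_rv X -> borel_rv Y -> borel_rv (X \+ Y).
Proof.
move=> [D [/countable_enum[e De] dD]] mX mY; apply: borel_rv_open => U oU.
have he a (r : R) : 0 < r -> exists n, ball a r (e n).
  move=> r0.
  have [b [bb Db]] := dD (ball a r) (ex_intro _ a (ballxx a r0)) (ball_open a r).
  by have [n en] := De _ Db; exists n; rewrite en.
(* The condition on the two balls does not involve [w], so [F i j n] is either an intersection of
   two preimages of balls or empty. *)
pose F i j n := [set w | (forall x y, ball (e i) n.+1%:R^-1 x ->
   ball (e j) n.+1%:R^-1 y -> U (x + y)) /\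
   (ball (e i) n.+1%:R^-1 (X w) /\ ball (e j) n.+1%:R^-1 (Y w))].
have -> : (X \+ Y) @^-1` U = \bigcup_i \bigcup_j \bigcup_n F i j n.
  apply/seteqP; split => [w /= Uw|w [i _ [j _ [n _ [h [hx hy]]]]]]; last exact: h.
  have [r /= r0 hr] : nbhs_ball (X w + Y w) U by rewrite nbhs_ballE; exact: open_nbhs_nbhs.
  (* Four distances below [r / 4] are added: from [X w] and from [x] to [e i], from [Y w] and from
     [y] to [e j]. *)
  have [n hn] : exists n : nat, n.+1%:R^-1 < r / 4.
    have r4 : 0 < r / 4 by rewrite divr_gt0.
    have /cvgrPdist_lt /(_ _ r4) [N _ hN] := @cvg_harmonic R.
    by exists N; move: (hN N (leqnn N)); rewrite /= sub0r normrN ger0_norm.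
  have n0 : 0 < n.+1%:R^-1 :> R by rewrite invr_gt0.
  have [i hi] := he (X w) _ n0; have [j hj] := he (Y w) _ n0.
  exists i => //; exists j => //; exists n => //; split; last by split; exact: ball_sym.
  move=> x y; move: hi hj; rewrite -!ball_normE /= => hi hj hx hy.
  apply: hr; rewrite -ball_normE /=.
  have -> : X w + Y w - (x + y) = (X w - e i) + (e i - x) + ((Y w - e j) + (e j - y)).
    by rewrite !addrA !subrK opprD addrACA addrA.
  apply: le_lt_trans (ler_normD _ _) _.
  have hX := le_lt_trans (ler_normD _ _) (ltrD (lt_trans hi hn) (lt_trans hx hn)).
  have hY := le_lt_trans (ler_normD _ _) (ltrD (lt_trans hj hn) (lt_trans hy hn)).
  by apply: lt_le_trans (ltrD hX hY) _; lra.
apply: bigcupT_measurable => i; apply: bigcupT_measurable => j.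
apply: bigcupT_measurable => n.
have [h|nh] := pselect (forall x y, ball (e i) n.+1%:R^-1 x ->
   ball (e j) n.+1%:R^-1 y -> U (x + y)).
  have -> : F i j n = X @^-1` ball (e i) n.+1%:R^-1 `&` Y @^-1` ball (e j) n.+1%:R^-1.
    by apply/seteqP; split => w /=; [case|].
  by apply: measurableI; [apply: mX|apply: mY]; apply: sub_sigma_algebra; apply: ball_open.
by rewrite (_ : F i j n = set0)//; apply/seteqP; split => w // -[].
Qed.

Lemma borel_rv_cst (T : topologicalType) (x : T) : borel_rv (fun _ : Omega => x).
Proof. by apply: borel_rv_open => U _; rewrite preimage_cst; case: ifP. Qed.

Lemma borel_rv_partial_sum (R : realType) (B : normedModType R)
    (Xs : nat -> Omega -> B) (n : nat) :
  separable B -> (forall k, borel_rv (Xs k)) -> borel_rv (partial_sum Xs n).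
Proof.
move=> sB mX; elim: n => [|n IH].
  have -> : partial_sum Xs 0 = fun=> 0 by apply/funext => w; rewrite /partial_sum big_ord0.
  exact: borel_rv_cst.
have -> : partial_sum Xs n.+1 = partial_sum Xs n \+ Xs n.
  by apply/funext => w; rewrite /partial_sum big_ord_recr.
exact: borel_rvD.
Qed.

End borel_rv_theory.

(** * The path space and the renewal property *)

(** Finite-dimensional rectangles: they form a pi-system, and [paths] carries the product
    sigma-algebra that they generate. *)
Definition cylinder (T : topologicalType) : set (set (nat -> T)) :=
  [set C | exists A N, (forall i, borel_set (A i)) /\
    (forall i, (N <= i)%N -> A i = setT) /\ C = [set x | forall i, A i (x i)]].

Definition paths (T : ptopologicalType) := g_sigma_algebraType (@cylinder T).

Lemma borel_setT (T : topologicalType) : borel_set [set: T].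
Proof. by apply: sub_sigma_algebra; exact: openT. Qed.

Lemma borel_setI (T : ptopologicalType) (A A' : set T) :
  borel_set A -> borel_set A' -> borel_set (A `&` A').
Proof. exact: (@measurableI _ (borel T)). Qed.

Lemma cylinder_setI (T : ptopologicalType) : setI_closed (@cylinder T).
Proof.
move=> _ _ [A [N [mA [AT ->]]]] [A' [N' [mA' [A'T ->]]]].
exists (fun i => A i `&` A' i), (maxn N N'); split; first by move=> i; exact: borel_setI.
split=> [i|]; first by rewrite geq_max => /andP[/AT-> /A'T->]; rewrite setIT.
by apply/seteqP; split=> [x [h h'] i|x h]; [split|split => i; case: (h i)].
Qed.

Lemma measurable_paths d (Omega : measurableType d) (T : ptopologicalType)
    (Y : nat -> Omega -> T) :
  (forall i, borel_rv (Y i)) -> measurable_fun setT ((fun w i => Y i w) : Omega -> paths T).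
Proof.
move=> mY; apply: (@measurability _ _ Omega (paths T) setT _ (@cylinder T)) => //.
move=> _ [_ [A [N [mA [AT ->]]]] <-]; rewrite setTI.
rewrite (_ : _ @^-1` _ = \bigcap_i (Y i @^-1` A i)).
  by apply: bigcapT_measurable => i; exact: mY.
by apply/seteqP; split => w /= h i => [_|]; apply: h.
Qed.

Lemma borel_rv_coord (T : ptopologicalType) (i : nat) :
  borel_rv (fun x : paths T => x i).
Proof.
move=> A mA; apply: sub_sigma_algebra.
exists (fun j => if j == i then A else setT), i.+1; split.
  by move=> j; case: ifP => // _; exact: borel_setT.
split=> [j ij|]; first by rewrite gtn_eqF.
apply/seteqP; split => [x /= Ax j|x /(_ i)/=]; last by rewrite eqxx.
by case: eqP => [->|].
Qed.

(** Both sides are finite measures in [C]; two finite measures of equal mass that agree on a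
    generating pi-system are equal. *)
Lemma dynkin_proportional d (Omega : measurableType d) (R : realType)
    (P : probability Omega R) d' (Y : measurableType d') (G : set (set Y))
    (phi psi : Omega -> Y) (E : set Omega) (c : R) :
  @measurable _ Y = <<s G>> -> setI_closed G -> G setT ->
  measurable_fun setT phi -> measurable_fun setT psi -> measurable E ->
  (forall C, G C -> P (E `&` phi @^-1` C) = c%:E * P (psi @^-1` C))%E ->
  forall C, measurable C -> (P (E `&` phi @^-1` C) = c%:E * P (psi @^-1` C))%E.
Proof.
move=> mYG IG GT mphi mpsi mE hG.
have mp C : measurable C -> measurable (phi @^-1` C).
  by move=> mC; rewrite -[_ @^-1` _]setTI; exact: mphi.
have mq C : measurable C -> measurable (psi @^-1` C).
  by move=> mC; rewrite -[_ @^-1` _]setTI; exact: mpsi.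
(* The full set forces [c = P E], which is what the complement step needs. *)
have PE : P E = c%:E by have := hG _ GT; rewrite !preimage_setT setIT probability_setT mule1.
rewrite mYG => C; move: C.
have tp (f : Omega -> Y) (F : nat -> set Y) :
    trivIset setT F -> trivIset setT (fun k => f @^-1` F k).
  by move=> tF i j Di Dj [w [h1 h2]]; apply: tF => //; exists (f w).
apply: (dynkin_induction mYG IG) => //=; first exact: hG.
  move=> C mC hC.
  have hC' : P (E `&` phi @^-1` C) = (c%:E * P (psi @^-1` C))%E by exact: hC.
  have mpC := mp _ mC; have mqC := mq _ mC.
  rewrite 2!preimage_setC -setDE.
  have -> : P (E `\` phi @^-1` C) = (P E - P (E `&` phi @^-1` C))%E.
    by apply: measureD => //; rewrite ltey_eq fin_num_measure.
  have -> : P (~` (psi @^-1` C)) = (1%:E - P (psi @^-1` C))%E by exact: probability_setC.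
  rewrite PE hC'.
  rewrite -(fineK (fin_num_measure P _ mqC)).
  by rewrite -EFinM -!EFinB -EFinM mulrBr mulr1.
move=> F mF tF hF; rewrite !preimage_bigcup setI_bigcupr.
rewrite !measure_bigcup//.
- rewrite -nneseriesZl// ; apply: eq_eseriesr => i _; exact: hF.
- by move=> i _; exact/mq.
- exact: tp.
- by move=> i _; apply: measurableI => //; exact: mp.
- exact/trivIset_setIl/tp.
Qed.

Section renewal.
Context {R : realType} {d : measure_display} {Omega : measurableType d}.
Variable P : probability Omega R.
Variables (T : ptopologicalType) (X : Omega -> T) (Xs : nat -> Omega -> T).
Hypothesis iid : iid_copies P X Xs.
Let mX : borel_rv X := iid.1.
Let mXs n : borel_rv (Xs n) := iid.2.1 n.

Lemma iid_initial_product (A : nat -> set T) (M : nat) :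
  (forall i, borel_set (A i)) ->
  P [set w | forall i, (i < M)%N -> A i (Xs i w)] =
  (\prod_(i < M) P (X @^-1` A i))%E.
Proof.
move=> mA; have [_ [_ [ind sd]]] := iid.
have := ind [fset i in iota 0 M]%fset A (fun i _ => mA i).
rewrite (_ : \bigcap_(i in _) _ = [set w | forall i, (i < M)%N -> A i (Xs i w)]); last first.
  apply/seteqP; split => w /= h i iM; apply: h => /=.
    by rewrite inE/= mem_iota.
  by move: iM => /=; rewrite inE/= mem_iota.
move=> ->; rewrite (perm_big (iota 0 M)) /=; last first.
  apply: uniq_perm; rewrite ?fset_uniq ?iota_uniq// => i.
  by rewrite -[LHS]/(i \in [fset i in iota 0 M]%fset) inE.
rewrite -[M in iota 0 M]subn0 -/(index_iota 0 M) big_mkord; apply: eq_bigr => i _; exact: sd.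
Qed.

Definition shifted (n : nat) (w : Omega) : paths T := fun i => Xs (n + i)%N w.
(* The first [n] variables, padded with [x0]: events of the past of time [n]
   are the preimages of measurable sets of paths under [stopped n x0]. *)
Definition stopped (n : nat) (x0 : T) (w : Omega) : paths T :=
  fun i => if (i < n)%N then Xs i w else x0.

Lemma measurable_shifted n : measurable_fun setT (shifted n).
Proof. by apply: measurable_paths => i; exact: mXs. Qed.

Lemma measurable_stopped n x0 : measurable_fun setT (stopped n x0).
Proof.
apply: (@measurable_paths _ _ _ (fun i w => if (i < n)%N then Xs i w else x0)) => i.
by have [_|_] := ltnP i n; [exact: mXs|exact: borel_rv_cst].
Qed.

Lemma measurable_shifted_preimage n (C : set (paths T)) :
  measurable C -> measurable (shifted n @^-1` C).
Proof. by move=> mC; rewrite -[_ @^-1` _]setTI; exact: measurable_shifted. Qed.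

Lemma measurable_stopped_preimage n x0 (C : set (paths T)) :
  measurable C -> measurable (stopped n x0 @^-1` C).
Proof. by move=> mC; rewrite -[_ @^-1` _]setTI; exact: measurable_stopped. Qed.

(** The two events together form a single rectangle [A2] in the first [n + N] variables, whose
    probability is a product that splits at [n]. *)
Lemma renewal_cylinder n x0 (C C' : set (paths T)) :
  cylinder C -> cylinder C' ->
  P (stopped n x0 @^-1` C' `&` shifted n @^-1` C) =
  (P (stopped n x0 @^-1` C') * P (shifted 0 @^-1` C))%E.
Proof.
move=> [A [N [mA [AT CE]]]] [A' [N' [mA' [A'T C'E]]]].
(* From index [n] on the stopped path is the constant [x0]: either it meets every constraint there,
   or the past event is empty. *)
have [h0|h0] := pselect (forall i, (n <= i)%N -> A' i x0); last first.
  rewrite (_ : stopped n x0 @^-1` C' = set0) ?set0I ?measure0 ?mul0e//.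
  apply/seteqP; split => // w; rewrite C'E /stopped/= => h; apply: h0 => i ni.
  by have := h i; rewrite ltnNge ni.
have e1 : stopped n x0 @^-1` C' = [set w | forall i, (i < n)%N -> A' i (Xs i w)].
  rewrite C'E; apply/seteqP; split => w /= h i; first by move=> iN; have := h i; rewrite /stopped iN.
  by rewrite /stopped; case: ltnP => iN; [exact: h|exact: h0].
have e2 k : shifted k @^-1` C = [set w | forall i, (i < N)%N -> A i (Xs (k + i)%N w)].
  rewrite CE; apply/seteqP; split => w /= h i; first by move=> iN; exact: h.
  by case: (ltnP i N) => iN; [exact: h|rewrite AT].
pose A2 i := if (i < n)%N then A' i else A (i - n)%N.
have -> : stopped n x0 @^-1` C' `&` shifted n @^-1` C =
   [set w | forall i, (i < n + N)%N -> A2 i (Xs i w)].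
  rewrite e1 e2; apply/seteqP; split => [w [/= h h'] i iN|w /= h].
    rewrite /A2; case: ltnP => iN'; first exact: h.
    by have := h' (i - n)%N; rewrite subnKC//; apply; lia.
  split => i iN.
    by have := h i (ltn_addr _ iN); rewrite /A2 iN.
  have := h (n + i)%N; rewrite ltn_add2l iN /A2 ltnNge leq_addr/= addKn.
  by apply.
rewrite e1 e2 !iid_initial_product//; last by move=> i; rewrite /A2; case: ifP.
rewrite big_split_ord/=; congr (_ * _)%E; apply: eq_bigr => i _.
  by rewrite /A2 ltn_ord.
by rewrite /A2 ltnNge leq_addr/= addKn.
Qed.

(* With [C' = setT] this is stationarity of the shifts, otherwise it is
   independence of past and future; it is enough to check cylinders, one
   argument at a time. *)
Lemma renewal n x0 (C C' : set (paths T)) : measurable C -> measurable C' ->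
  P (stopped n x0 @^-1` C' `&` shifted n @^-1` C) =
  (P (stopped n x0 @^-1` C') * P (shifted 0 @^-1` C))%E.
Proof.
have setTcyl : cylinder [set: paths T].
  exists (fun=> setT), 0%N; split; first by move=> _; exact: borel_setT.
  by split => //; apply/seteqP; split.
have mS0 := measurable_shifted_preimage 0.
have mS := measurable_shifted_preimage n.
have mH := measurable_stopped_preimage n x0.
have cylm (C0 : set (paths T)) : cylinder C0 -> measurable C0 by exact: sub_sigma_algebra.
have fin A : measurable A -> P A \is a fin_num by move=> mA; exact: fin_num_measure.
(* The future cylinder is fixed first and the past event extended; then the past event is fixed and
   the future one extended. *)
have gen (C0 : set (paths T)) : cylinder C0 -> forall C1, measurable C1 ->
    P (stopped n x0 @^-1` C1 `&` shifted n @^-1` C0) =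
    (P (stopped n x0 @^-1` C1) * P (shifted 0 @^-1` C0))%E.
  move=> cC0 C1 mC1; rewrite setIC muleC -(fineK (fin _ (mS0 _ (cylm _ cC0)))).
  move: C1 mC1; apply: (@dynkin_proportional _ _ _ P _ (paths T) (@cylinder T) (stopped n x0) (stopped n x0)) => //.
  - exact: cylinder_setI.
  - exact: measurable_stopped.
  - exact: measurable_stopped.
  - by apply: mS; exact: cylm.
  - by move=> C2 cC2; rewrite setIC fineK ?fin//; [rewrite muleC; exact: renewal_cylinder|by apply: mS0; exact: cylm].
move=> mC mC'; rewrite -(fineK (fin _ (mH _ mC'))).
move: C mC; apply: (@dynkin_proportional _ _ _ P _ (paths T) (@cylinder T) (shifted n) (shifted 0)) => //.
- exact: cylinder_setI.
- exact: measurable_shifted.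
- exact: measurable_shifted.
- exact: mH.
- by move=> C2 cC2; rewrite fineK ?fin//; [exact: gen|exact: mH].
Qed.

End renewal.

(** * Growth of the partial sums *)

(** Continuity from above: the tail unions decrease to the event that infinitely many [E n] occur,
    which is null. *)
Lemma probability_tail_union_lt d (Omega : measurableType d) (R : realType)
    (P : probability Omega R) (E : nat -> set Omega) :
  (forall n, measurable (E n)) ->
  {ae P, forall w, exists N, forall n, (N <= n)%N -> ~ E n w} ->
  forall e : R, 0 < e ->
  exists N, (P (\bigcup_(n in [set n | (N <= n)%N]) E n) < e%:E)%E.
Proof.
move=> mE [Z [mZ PZ hZ]] e e0.
pose F N := \bigcup_(n in [set n | (N <= n)%N]) E n.
have mF N : measurable (F N) by exact: bigcup_measurable.
have mI : measurable (\bigcap_n F n) by exact: bigcapT_measurable.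
have PI : P (\bigcap_n F n) = 0%E.
  apply/eqP; rewrite eq_le measure_ge0 andbT -PZ le_measure ?inE//.
  move=> w hw; apply: hZ => /= -[N hN].
  by have [n Nn] := hw N I; exact: hN.
have cv : (P \o F) x @[x --> \oo] --> 0%E.
  rewrite -PI; apply: nonincreasing_cvg_mu => //.
    by rewrite ltey_eq fin_num_measure.
  move=> m n mn; apply/subsetPset => w [k /= nk Ek]; exists k => //=.
  exact: leq_trans nk.
have : \forall x \near \oo, ((P \o F) x < e%:E)%E.
  by apply: (cv [set y | (y < e%:E)%E]); apply: open_ereal_lt'; rewrite lte_fin.
by move=> [N _ hN]; exists N; exact: (hN N (leqnn N)).
Qed.

(** Since [(1 - u) (1 + S + u) <= 1 + S], the product times [1 + sum] never exceeds 1. This is a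
    quantitative converse Borel-Cantelli bound. *)
Lemma sum_le1_of_prodC_ge_half (R : realType) (u : nat -> R) (M : nat) :
  (forall i, 0 <= u i <= 1) -> 1 / 2 <= \prod_(i < M) (1 - u i) ->
  \sum_(i < M) u i <= 1.
Proof.
move=> u01 h.
have : (\prod_(i < M) (1 - u i)) * (1 + \sum_(i < M) u i) <= 1 /\
  0 <= \prod_(i < M) (1 - u i) /\ 0 <= \sum_(i < M) u i.
  elim: M {h} => [|M [IH1 [IH2 IH3]]]; first by rewrite !big_ord0 addr0 mulr1.
  rewrite !big_ord_recr/=; have /andP[u0 u1] := u01 M.
  set Q := \prod_(i < M) _ in IH1 IH2 *; set S := \sum_(i < M) _ in IH1 IH3 *.
  split; last by split; [rewrite mulr_ge0// subr_ge0|rewrite addr_ge0].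
  apply: le_trans IH1; rewrite -mulrA ler_wpM2l//.
  nra.
move=> [h1 [h2 h3]]; nra.
Qed.

Lemma measurable_set_ltr d (T : measurableType d) (R : realType) (f g : T -> R) :
  measurable_fun setT f -> measurable_fun setT g -> measurable [set x | f x < g x].
Proof.
move=> mf mg; have := measurable_fun_ltr mf mg measurableT (_ : measurable [set true]).
by rewrite setTI preimage_true; apply.
Qed.

(** * First passage of the partial sums above [n^q] *)

Section partial_sum_growth.
Context {R : realType} {B : normedModType R} {d : measure_display}
  {Omega : measurableType d}.
Variable P : probability Omega R.
Variables (X : Omega -> B) (Xs : nat -> Omega -> B) (q : R).
Hypotheses (sepB : separable B) (iid : iid_copies P X Xs) (q0 : 0 < q).

Let mXs n : borel_rv (Xs n) := iid.2.1 n.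
Let S n w := `|partial_sum Xs n w|.
Let c n : R := n%:R `^ q.
Let block n w := \sum_(n <= j < n + n + n) S j w.

Hypothesis block_small : {ae P, forall w, forall e : R, 0 < e ->
  exists N, forall n, (N <= n)%N -> block n w <= e * (n%:R * c n)}.

Let mS n : measurable_fun setT (S n).
Proof. by apply: borel_rv_norm; exact: borel_rv_partial_sum. Qed.

Let c_ge0 n : 0 <= c n. Proof. exact: powR_ge0. Qed.
Let c_gt0 n : (0 < n)%N -> 0 < c n. Proof. by move=> n0; rewrite powR_gt0// ltr0n. Qed.

(** A functional of the path, so that the same event can be read on shifted and on stopped paths. *)
Let psum n (x : paths B) := `|partial_sum (fun k (y : paths B) => y k) n x|.

Let mpsum n : measurable_fun setT (psum n).
Proof.
apply: borel_rv_norm; apply: borel_rv_partial_sum => // k; exact: borel_rv_coord.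
Qed.

Let psum_shifted k i w : psum i (shifted Xs k w) = `|partial_sum Xs (k + i) w - partial_sum Xs k w|.
Proof.
by rewrite /psum /partial_sum big_split_ord/= [X in `|X - _|]addrC addrK.
Qed.

Let psum_stopped n i w : (i <= n)%N -> psum i (stopped Xs n 0 w) = S i w.
Proof.
move=> ni; rewrite /psum /S /partial_sum; congr `|_|; apply: eq_bigr => j _.
by rewrite /stopped (leq_trans (ltn_ord j) ni).
Qed.

Let bad n : set (paths B) := [set x | n%:R * c n / 2 < \sum_(i < n) psum i x].

Let mbad n : measurable (bad n).
Proof.
apply: measurable_set_ltr => //.
by apply: measurable_sum => i; exact: mpsum.
Qed.

(** With the constant 1/16, off this event the bound [4 * block / c n] on the number of bad starting
    points is at most [n / 4]. *)
Let bigblock n := [set w | 16^-1 * (n%:R * c n) < block n w].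

Let mbigblock n : measurable (bigblock n).
Proof.
apply: measurable_set_ltr => //.
by apply: measurable_sum => i; exact: mS.
Qed.

Let tail_bigblock N := \bigcup_(n in [set n | (N <= n)%N]) bigblock n.

Let mtail_bigblock N : measurable (tail_bigblock N).
Proof. exact: bigcup_measurable. Qed.

Let tail_bigblock_small : exists N, (P (tail_bigblock N) < (4^-1)%:E)%E.
Proof.
apply: probability_tail_union_lt => //.
apply: filterS block_small => w /(_ 16^-1 ltac:(by rewrite invr_gt0)) [N hN].
by exists N => n /hN h; rewrite /bigblock/= => /(le_lt_trans h); rewrite ltxx.
Qed.

Let P_shifted k C : measurable C -> P (shifted Xs k @^-1` C) = P (shifted Xs 0 @^-1` C).
Proof.
move=> mC; have := renewal iid k 0 mC (@measurableT _ _).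
by rewrite !preimage_setT setTI probability_setT mul1e.
Qed.

(** Off [tail_bigblock N] at most [n / 4] starting points are bad; on it, of probability below 1/4,
    at most [n] are. The mean number is therefore at most [n / 2]. *)
Let P_bad_le N n : (P (tail_bigblock N) < (4^-1)%:E)%E -> (N <= n)%N -> (0 < n)%N ->
  (P (shifted Xs 0 @^-1` bad n) <= (2^-1)%:E)%E.
Proof.
move=> PN Nn n0.
have mB k : measurable (shifted Xs k @^-1` bad n) by exact: (measurable_shifted_preimage iid).
have nr : 0 < n%:R :> R by rewrite ltr0n.
(* All the shifts have the same probability of being bad, so [n] times that
   probability is the mean number of bad starting points in [[n, 2n)]. *)
have le1 w : \sum_(n <= k < n + n) \1_(shifted Xs k @^-1` bad n) w <=
    n%:R / 4 + n%:R * \1_(tail_bigblock N) w :> R.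
  rewrite [in leRHS]indicE; case: (boolP (w \in _)) => [_|].
    rewrite mulr1; apply: ler_wpDl; first by rewrite divr_ge0.
    have -> : n%:R = \sum_(n <= k < n + n) 1 :> R.
      by rewrite sumr_const_nat addKn.
    by apply: ler_sum => k _; rewrite indicE; case: (_ \in _).
  move=> wN; rewrite mulr0 addr0.
  have hb : block n w <= 16^-1 * (n%:R * c n).
    rewrite leNgt; apply: contra wN => h; rewrite inE; exists n => //.
  apply: (@le_trans _ _ (4 * block n w / c n)).
    have := @count_large_increments_le R (fun k => S k w)
      (fun k i => psum i (shifted Xs k w)) n (c n) n0 (c_gt0 n0).
    move=> h; have {}h := h (fun k => normr_ge0 _) _.
    apply: le_trans (h _) => [|k i].
      apply: ler_sum => k _; rewrite indicE le_eqVlt; apply/orP; left; apply/eqP.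
      by congr ((_ : bool)%:R); apply/idP/idP; rewrite inE.
    by rewrite psum_shifted; exact: ler_normB.
  rewrite ler_pdivrMr ?c_gt0//; lra.
have sumE : (n%:R%:E * P (shifted Xs 0 @^-1` bad n) =
    \int[P]_w (\sum_(n <= k < n + n) (\1_(shifted Xs k @^-1` bad n) w)%:E))%E.
  rewrite ge0_integral_sum//; last first.
    by move=> k; apply/measurable_EFinP; exact: measurable_indic.
  transitivity (\sum_(n <= k < n + n) P (shifted Xs 0 @^-1` bad n))%E; last first.
    by apply: eq_bigr => k _; rewrite integral_indic// setIT; exact/esym/P_shifted.
  rewrite -[P _]fineK ?fin_num_measure//.
  by rewrite sumEFin sumr_const_nat addKn -EFinM mulr_natl.
have intle : (\int[P]_w (\sum_(n <= k < n + n) (\1_(shifted Xs k @^-1` bad n) w)%:E) <=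
    \int[P]_w ((n%:R / 4)%:E + (n%:R)%:E * (\1_(tail_bigblock N) w)%:E))%E.
  apply: ge0_le_integral => //.
  - by move=> w _; apply: sume_ge0 => k _; rewrite lee_fin.
  - apply: emeasurable_sum => k; apply/measurable_EFinP; exact: measurable_indic.
  - apply: emeasurable_funD => //; apply: emeasurable_funM => //.
    by apply/measurable_EFinP; exact: measurable_indic.
  - by move=> w _; rewrite sumEFin -EFinM -EFinD lee_fin.
have mind : measurable_fun setT (fun w => (\1_(tail_bigblock N) w : R)%:E).
  by apply/measurable_EFinP; exact: measurable_indic.
have intE : (\int[P]_w ((n%:R / 4)%:E + (n%:R)%:E * (\1_(tail_bigblock N) w)%:E) =
    (n%:R / 4)%:E + n%:R%:E * P (tail_bigblock N))%E.
  rewrite ge0_integralD//; last first.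
    exact: emeasurable_funM.
  rewrite integral_cst// ge0_integralZl_EFin//= integral_indic// setIT.
  by rewrite [X in (_ * X + _)%E]probability_setT mule1.
rewrite -sumE intE in intle.
move: intle PN; rewrite -[P (shifted _ _ @^-1` _)]fineK ?fin_num_measure//.
rewrite -[P (tail_bigblock N)]fineK ?fin_num_measure//.
rewrite -!EFinM -EFinD !lee_fin lte_fin => h1 h2.
rewrite -(ler_pM2l nr); apply: le_trans h1 _.
have : n%:R * fine (P (tail_bigblock N)) <= n%:R * 4^-1 by rewrite ler_pM2l// ltW.
lra.
Qed.

Let tail_large N := \bigcup_(n in [set n | (N <= n)%N]) [set w | c n < S n w].

Let mlarge n : measurable [set w | c n < S n w].
Proof. exact: measurable_set_ltr. Qed.

(** Decomposition by first passage: a passage at [n] followed by small increments forces a big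
    block, and the increments are small with probability at least 1/2 independently of the past. *)
Let P_tail_large_le N : (P (tail_bigblock N) < (4^-1)%:E)%E -> (0 < N)%N ->
  (P (tail_large N) <= (2^-1)%:E)%E.
Proof.
move=> PN N0.
pose F n : set (paths B) := if (N <= n)%N then [set x | c n < psum n x] else set0.
pose L n : set Omega := if (N <= n)%N then [set w | c n < S n w] else set0.
(* [seqDU L n] is the event that [n] is the first time after [N] at which
   [c n < S n]. *)
have mF n : measurable (F n).
  by rewrite /F; case: ifP => // _; apply: measurable_set_ltr.
have mL n : measurable (L n) by rewrite /L; case: ifP.
have tailE : tail_large N = \bigcup_n seqDU L n.
  rewrite -seqDU_bigcup_eq /tail_large /L; apply/seteqP; split=> w [n /= Nn].
    by move=> h; exists n => //; rewrite Nn.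
  by case: ifP => // Nn' h; exists n.
(* First passage at [n] is determined by the first [n] variables, hence by the stopped path. *)
have LE n : seqDU L n = stopped Xs n 0 @^-1` seqDU F n.
  have LF m w : (m <= n)%N -> L m w <-> F m (stopped Xs n 0 w).
    by move=> mn; rewrite /L /F; case: ifP => //= _; rewrite psum_stopped.
  rewrite /seqDU -!bigcup_mkord; apply/seteqP; split=> w /= [h1 h2]; split.
  - exact/LF.
  - by move=> [m /= mn Fm]; apply: h2; exists m => //; apply/LF => //; exact: ltnW.
  - exact/LF.
  - by move=> [m /= mn Fm]; apply: h2; exists m => //; apply/LF => //; exact: ltnW.
have mdL n : measurable (seqDU L n) by exact: seqDU_measurable.
have mdF n : measurable (seqDU F n) by exact: seqDU_measurable.
pose G n := shifted Xs n @^-1` (~` bad n).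
have mnbad n : measurable (~` bad n) by exact: measurableC.
have mG n : measurable (G n) by exact: (measurable_shifted_preimage iid).
have half n : (P (seqDU L n) <= 2%:E * P (seqDU L n `&` G n))%E.
  have [Nn|nN] := leqP N n; last first.
    rewrite (_ : seqDU L n = set0) ?measure0 ?set0I ?measure0 ?mule0//.
    by rewrite /seqDU /L leqNgt nN set0D.
  have -> : P (seqDU L n `&` G n) = (P (seqDU L n) * P (shifted Xs 0 @^-1` (~` bad n)))%E.
    by rewrite LE; exact: (renewal iid).
  have := P_bad_le PN Nn (leq_trans N0 Nn).
  have mb : measurable (shifted Xs 0 @^-1` bad n) by exact: (measurable_shifted_preimage iid).
  have -> : P (shifted Xs 0 @^-1` (~` bad n)) = (1%:E - P (shifted Xs 0 @^-1` bad n))%E.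
    by rewrite preimage_setC; exact: probability_setC.
  rewrite -[P (shifted _ _ @^-1` _)]fineK ?fin_num_measure// lee_fin => hb.
  have p0 : (0 <= fine (P (seqDU L n))) by rewrite fine_ge0.
  rewrite -[P (seqDU L n)]fineK ?fin_num_measure// -EFinB -!EFinM lee_fin.
  nra.
(* The block is at least [n * c n / 2], well above the threshold [n * c n / 16]. *)
have sub : \bigcup_n (seqDU L n `&` G n) `<=` tail_bigblock N.
  move=> w [n _ [[Ln _] Gn]]; move: Ln; rewrite /L; case: ifP => // Nn /= cS.
  exists n => //; rewrite /bigblock/=.
  have n0 : (0 < n)%N by exact: leq_trans N0 Nn.
  have : n%:R * c n / 2 <= block n w.
    apply: (@block_sum_ge_of_small_increments R (fun k => S k w)
      (fun i => psum i (shifted Xs n w))) => //.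
    - by move=> k; exact: normr_ge0.
    - by move=> i; rewrite psum_shifted addrC -lerBlDr distrC; exact: lerB_dist.
    - exact: ltW.
    - by move: Gn; rewrite /G /bad /= => /negP; rewrite -leNgt.
  apply: lt_le_trans.
  have : 0 < n%:R * c n by rewrite mulr_gt0 ?c_gt0 ?ltr0n.
  lra.
have tI : trivIset setT (fun n => seqDU L n `&` G n).
  by apply: trivIset_setIr; exact: trivIset_seqDU.
have PU : P (\bigcup_n (seqDU L n `&` G n)) = (\sum_(0 <= n <oo) P (seqDU L n `&` G n))%E.
  apply: measure_semi_bigcup => //; first by move=> n; exact: measurableI.
  by apply: bigcupT_measurable => n; exact: measurableI.
have PT : P (tail_large N) = (\sum_(0 <= n <oo) P (seqDU L n))%E.
  rewrite tailE; apply: measure_semi_bigcup => //.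
  by apply: bigcupT_measurable.
have h1 : (P (tail_large N) <= 2%:E * P (tail_bigblock N))%E.
  apply: (@le_trans _ _ (2%:E * P (\bigcup_n (seqDU L n `&` G n)))%E); last first.
    rewrite lee_pmul2l// le_measure ?inE//.
    by apply: bigcupT_measurable => n; exact: measurableI.
  rewrite PT PU -nneseriesZl//; exact: lee_nneseries.
apply: le_trans h1 _; move: PN.
rewrite -[P _]fineK ?fin_num_measure// -EFinM lee_fin lte_fin => PN.
lra.
Qed.

(** With probability at least 1/2 no [|S_n|] with [n >= N] exceeds [c n], which bounds every later
    [|X_n|]; independence turns this into a lower bound on a product of probabilities. *)
Lemma tail_probability_bounded :
  exists C : R, forall M,
  \sum_(0 <= n < M) fine (P [set w | 2 * (n.+1%:R `^ q) < `|X w|]) <= C.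
Proof.
have [N0 PN0] := tail_bigblock_small.
(* The successor makes [N] positive, as the first-passage bound requires. *)
pose N := N0.+1.
have PN : (P (tail_bigblock N) < (4^-1)%:E)%E.
  apply: le_lt_trans PN0; rewrite le_measure ?inE// => w [n /= Nn h].
  by exists n => //=; exact: ltnW.
have PT := P_tail_large_le PN (ltn0Sn _).
pose p n := fine (P [set w | 2 * c n.+1 < `|X w|]).
have mXn n : measurable [set w | 2 * c n.+1 < `|X w|].
  by apply: measurable_set_ltr => //; apply: borel_rv_norm; exact: iid.1.
have p01 n : 0 <= p n <= 1.
  rewrite fine_ge0//= -lee_fin fineK ?fin_num_measure//.
  exact: probability_le1.
(* Indices below [N] are left unconstrained: their factor is 1, and their probabilities are added
   back at the end. *)
pose u n := if (N <= n)%N then p n else 0.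
have u01 n : 0 <= u n <= 1 by rewrite /u; case: ifP => //; rewrite lexx ler01.
pose A n : set B := if (N <= n)%N then ~` [set x | 2 * c n.+1 < `|x|] else setT.
have mA n : borel_set (A n).
  rewrite /A; case: ifP => _; last exact: borel_setT.
  apply: (@measurableC _ (borel B)); apply: (@measurable_set_ltr _ (borel B)) => //.
  by apply: (@borel_rv_norm _ (borel B)) => // U.
have PA n : P (X @^-1` A n) = (1 - u n)%:E.
  rewrite /A /u; case: ifP => _; last by rewrite preimage_setT probability_setT subr0.
  rewrite preimage_setC EFinB /p fineK ?fin_num_measure//.
  exact: (probability_setC P (mXn n)).
have mT : measurable (tail_large N) by exact: bigcup_measurable.
have prod_ge M : 1 / 2 <= \prod_(i < M) (1 - u i).
  rewrite -lee_fin -prodEFin; under eq_bigr do rewrite -PA.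
  rewrite -(iid_initial_product iid M mA).
  apply: (@le_trans _ _ (P (~` tail_large N))).
    rewrite [leRHS](_ : _ = 1%:E - P (tail_large N))%E; last exact: probability_setC.
    move: PT; rewrite -[P _]fineK ?fin_num_measure// -EFinB !lee_fin; lra.
  rewrite le_measure ?inE//; first exact: measurableC.
    rewrite (_ : [set _ | _] = \bigcap_(i in [set i | (i < M)%N]) (Xs i @^-1` A i)).
      by apply: bigcap_measurableType => i _; exact: mXs.
    by apply/seteqP; split => w /= h i; exact: h.
  move=> w /= hw i iM; rewrite /A; case: ifPn => //= Ni; apply/negP; rewrite -leNgt.
  have hS k : (N <= k)%N -> S k w <= c k.
    by move=> Nk; rewrite leNgt; apply/negP => h; apply: hw; exists k.
  (* Variables are numbered from 0, so [Xs i] is the increment from time [i] to [i + 1], whence the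
     threshold [2 * c i.+1]. *)
  have -> : Xs i w = partial_sum Xs i.+1 w - partial_sum Xs i w.
    by rewrite /partial_sum big_ord_recr/= [X in X - _]addrC addrK.
  apply: le_trans (ler_normB _ _) _.
  have h1 := hS i.+1 (leqW Ni); have h2 := hS i Ni.
  have h3 : c i <= c i.+1.
    by apply: ge0_ler_powR; rewrite ?nnegrE ?ler_nat// ltW.
  by rewrite -/(S i.+1 w) -/(S i w); lra.
exists (\sum_(0 <= n < N) p n + 1) => M.
apply: (@le_trans _ _ (\sum_(0 <= n < N + M) p n)).
  apply: ler_sum_nat_widen => //; last exact: leq_addl.
  by move=> j; have /andP[] := p01 j.
rewrite (big_cat_nat (leq0n N) (leq_addr M N))/= lerD2l.
have u0 j : 0 <= u j by have /andP[] := u01 j.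
apply: (@le_trans _ _ (\sum_(0 <= n < N + M) u n)).
  apply: le_trans (ler_sum_nat_widen u0 (leq0n N) (leqnn _)).
  by rewrite !big_nat; apply: ler_sum => n /andP[Nn _]; rewrite /u Nn.
rewrite big_mkord; exact: sum_le1_of_prodC_ge_half.
Qed.
End partial_sum_growth.

(** * Moments and series *)

Lemma integral_same_distribution d (Omega : measurableType d) (R : realType)
    (P : probability Omega R) (T : ptopologicalType) (X Y : Omega -> T)
    (f : T -> \bar R) :
  borel_rv X -> borel_rv Y -> same_distribution P X Y ->
  measurable_fun setT (f : borel T -> \bar R) -> (forall x, 0 <= f x)%E ->
  (\int[P]_w f (X w) = \int[P]_w f (Y w))%E.
Proof.
move=> /borel_rv_measurable mX /borel_rv_measurable mY XY mf f0.
have := ge0_integral_pushforward mX P measurableT mf (fun x _ => f0 x).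
have := ge0_integral_pushforward mY P measurableT mf (fun x _ => f0 x).
rewrite !preimage_setT => <- <-.
by apply: eq_measure_integral => A mA _; exact: XY.
Qed.

(** For [n <= j < 3n], [j^(1+q) <= (3n)^(1+q) = K n^(1+q)], so the block is at most [K n^(1+q)]
    times a piece of the tail of the weighted series. *)
Lemma block_le_of_bounded_partial_sums (R : realType) (s : nat -> R) (q : R) :
  0 < q -> (forall n, 0 <= s n) ->
  (exists C : R, forall M, \sum_(1 <= n < M) n%:R^-1 * (s n / n%:R `^ q) <= C) ->
  forall e : R, 0 < e -> exists N, forall n, (N <= n)%N ->
    \sum_(n <= j < n + n + n) s j <= e * (n%:R * n%:R `^ q).
Proof.
move=> q0 s0 hC e e0.
have u0 n : 0 <= n%:R^-1 * (s n / n%:R `^ q).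
  by rewrite mulr_ge0 ?divr_ge0 ?powR_ge0// invr_ge0.
pose K : R := 3 * 3 `^ q.
have K0 : 0 < K by rewrite mulr_gt0 ?powR_gt0.
have [N hN] := bounded_partial_sums_tail u0 hC (divr_gt0 e0 K0).
exists N.+1 => n Nn; have n0 : (0 < n)%N by exact: leq_trans Nn.
have nq0 : 0 < n%:R * n%:R `^ q :> R by rewrite mulr_gt0 ?powR_gt0 ?ltr0n.
apply: (@le_trans _ _ (K * (n%:R * n%:R `^ q) *
    \sum_(n <= j < n + n + n) j%:R^-1 * (s j / j%:R `^ q))).
  rewrite mulr_sumr !big_nat; apply: ler_sum => j /andP[nj jn].
  have j0 : (0 : R) < j%:R by rewrite ltr0n; exact: leq_trans nj.
  have jq0 : 0 < j%:R `^ q by rewrite powR_gt0.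
  have -> : K * (n%:R * n%:R `^ q) * (j%:R^-1 * (s j / j%:R `^ q)) =
      s j * ((K * (n%:R * n%:R `^ q)) / (j%:R * j%:R `^ q)).
    by field; rewrite !gt_eqF.
  rewrite ler_peMr// ler_pdivlMr ?mulr_gt0// mul1r.
  have -> : K * (n%:R * n%:R `^ q) = (3 * n%:R) * (3 * n%:R) `^ q.
    by rewrite powRM// /K; ring.
  have j3 : j%:R <= 3 * n%:R :> R by rewrite -natrM ler_nat; lia.
  rewrite ler_pM ?powR_ge0//.
  by apply: ge0_ler_powR; rewrite ?nnegrE// ltW.
apply: (@le_trans _ _ (K * (n%:R * n%:R `^ q) * (e / K))).
  rewrite ler_wpM2l ?mulr_ge0 ?powR_ge0 ?(ltW K0)//.
  by apply: hN; [exact: ltnW|rewrite -addnA leq_addr].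
by rewrite le_eqVlt; apply/orP; left; apply/eqP; field; rewrite gt_eqF.
Qed.

(** The series counts the [n] with [n + 1 < y], where [y = (x / 2)^p]; there are at least
    [truncn y - 1] of them, and the summand 2 absorbs the rounding. *)
Lemma powR_le_tail_count (R : realType) (p x : R) : 0 < p -> 0 <= x ->
  ((x `^ p)%:E <= (2 `^ p)%:E *
    (2%:E + \sum_(0 <= n <oo) ((2 * n.+1%:R `^ p^-1 < x)%R%:R)%:E))%E.
Proof.
move=> p0 x0; set y := (x / 2) `^ p.
have y0 : 0 <= y by exact: powR_ge0.
have -> : x `^ p = 2 `^ p * y.
  by rewrite /y -powRM ?divr_ge0//; congr (_ `^ _); field.
rewrite EFinM lee_pmul2l ?lte_fin ?powR_gt0//.
have /andP[Ny yN] := truncn_itv y0; set N := Num.truncn y in Ny yN.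
have big n : (n.+1 < N)%N -> 2 * n.+1%:R `^ p^-1 < x.
  move=> nN; rewrite ltNge; apply/negP => h.
  have : y <= n.+1%:R.
    have h' : x / 2 <= n.+1%:R `^ p^-1 by lra.
    have := @ge0_ler_powR _ _ (ltW p0) (x / 2) (n.+1%:R `^ p^-1).
    rewrite !nnegrE divr_ge0// powR_ge0 => /(_ isT isT h').
    by rewrite -powRrM mulVf ?gt_eqF// powRr1.
  apply/negP; rewrite -ltNge; apply: lt_le_trans Ny.
  by rewrite ltr_nat.
have h := @nneseries_lim_ge R (fun n => ((2 * n.+1%:R `^ p^-1 < x)%R%:R)%:E) xpredT 0%N N.-1
  (fun n _ _ => _).
apply: (@le_trans _ _ (2%:E + (N.-1%:R)%:E)%E).
  rewrite -EFinD lee_fin; apply: ltW; apply: (lt_le_trans yN).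
  by rewrite -natrD ler_nat; lia.
rewrite leeD2l//; apply: le_trans (h _); last by move=> n; rewrite lee_fin.
rewrite sumEFin lee_fin big_nat.
rewrite (eq_bigr (fun=> 1)); first by rewrite -big_nat sumr_const_nat subn0.
by move=> n /andP[_ nN]; rewrite big//; lia.
Qed.

(** * The two equivalences *)

Section main.
Context {R : realType} {B : normedModType R} {d : measure_display}
  {Omega : measurableType d}.
Variable P : probability Omega R.
Variables (X : Omega -> B) (Xs : nat -> Omega -> B) (p : R).
Hypotheses (iid : iid_copies P X Xs) (p01 : 0 < p < 1).

Let mX : borel_rv X := iid.1.
Let mXs n : borel_rv (Xs n) := iid.2.1 n.
Let q := p^-1.

Let q1 : 1 < q. Proof. by case/andP: p01 => p0 p1; rewrite /q invf_gt1. Qed.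
Let q0 : 0 < q. Proof. exact: lt_trans q1. Qed.

Let mnormX : measurable_fun setT (fun w => `|X w|).
Proof. exact: borel_rv_norm. Qed.

Let mnormXs n : measurable_fun setT (fun w => `|Xs n w|).
Proof. exact: borel_rv_norm. Qed.

Let mnormB : measurable_fun setT ((fun x => `|x|) : borel B -> R).
Proof. by apply: (@borel_rv_norm _ (borel B)) => U. Qed.

Let term n w := n%:R^-1 * (`|partial_sum Xs n w| / n%:R `^ q).

Let term_ge0 n w : 0 <= term n w.
Proof. by rewrite mulr_ge0 ?divr_ge0 ?powR_ge0// invr_ge0. Qed.

(** Integrating [powR_le_tail_count] bounds [E|X|^p] by [2^p] times 2 plus the sum of the tail
    probabilities. *)
Lemma moment_lty_of_series : separable B ->
  {ae P, forall w, (\sum_(1 <= n <oo) (term n w)%:E < +oo)%E} ->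
  (\int[P]_w (`|X w| `^ p)%:E < +oo)%E.
Proof.
move=> sB hs; have [p0 _] := andP p01.
have [C hC] : exists C : R, forall M,
    \sum_(0 <= n < M) fine (P [set w | 2 * (n.+1%:R `^ q) < `|X w|]) <= C.
  apply: (tail_probability_bounded sB iid q0).
  apply: filterS hs => w /(nneseries_ltyP 1 (fun n => term_ge0 n w)).1.
  exact: block_le_of_bounded_partial_sums.
have mE n : measurable [set w | 2 * (n.+1%:R `^ q) < `|X w|].
  exact: measurable_set_ltr.
have mI n : measurable_fun setT (fun w => (((2 * n.+1%:R `^ q < `|X w|)%R%:R : R)%:E)).
  apply/measurable_EFinP.
  rewrite (_ : (fun w => _) = \1_[set w | 2 * (n.+1%:R `^ q) < `|X w|]).
    exact: measurable_indic.
  by apply/funext => w; rewrite indicE; congr ((_ : bool)%:R); apply/idP/idP; rewrite inE.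
have mSm : measurable_fun setT (fun w =>
    \sum_(0 <= n <oo) (((2 * n.+1%:R `^ q < `|X w|)%R%:R : R)%:E))%E.
  have := @ge0_emeasurable_sum _ _ R setT (fun n w => (((2 * n.+1%:R `^ q < `|X w|)%R%:R : R)%:E)) xpredT.
  apply; last by move=> k _; exact: mI.
  by move=> k w _ _; rewrite lee_fin.
have Sm0 w : (0 <= \sum_(0 <= n <oo) (((2 * n.+1%:R `^ q < `|X w|)%R%:R : R)%:E))%E.
  by apply: nneseries_ge0 => n _ _; rewrite lee_fin.
apply: (@le_lt_trans _ _ (\int[P]_w ((2 `^ p)%:E *
    (2%:E + \sum_(0 <= n <oo) (((2 * n.+1%:R `^ q < `|X w|)%R%:R : R)%:E))))%E).
  apply: ge0_le_integral => //.
  - apply/measurable_EFinP.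
    by apply: (measurableT_comp (measurable_powR p)).
  - by apply: emeasurable_funM => //; exact: emeasurable_funD.
  - by move=> w _; exact: powR_le_tail_count.
rewrite ge0_integralZl_EFin ?powR_ge0//; [|by move=> w _; rewrite adde_ge0// lee_fin|exact: emeasurable_funD].
rewrite ge0_integralD// integral_cst// [X in (_ * (_ * X + _))%E]probability_setT mule1.
rewrite integral_nneseries//.
rewrite (_ : (\sum_(0 <= n <oo) _)%E = (\sum_(0 <= n <oo)
    (fine (P [set w | 2 * (n.+1%:R `^ q) < `|X w|]))%:E)%E); last first.
  apply: eq_eseriesr => n _; rewrite fineK ?fin_num_measure//.
  rewrite -[in RHS](setIT [set w | _]) -integral_indic//.
  apply: eq_integral => w _; rewrite indicE; congr (((_ : bool)%:R)%:E).
  by apply/idP/idP; rewrite inE.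
rewrite lte_mul_pinfty ?lee_fin ?powR_ge0// lte_add_pinfty ?ltry//.
apply/nneseries_ltyP; first by move=> n; rewrite fine_ge0.
by exists C.
Qed.

(** Truncation at 1 keeps expectations under control even when [E|X|] is infinite. *)
Lemma series_lty_of_moment :
  (\int[P]_w (`|X w| `^ p)%:E < +oo)%E ->
  {ae P, forall w, (\sum_(1 <= n <oo) (term n w)%:E < +oo)%E}.
Proof.
move=> hp; have [p0 _] := andP p01.
pose f k (x : B) : \bar R := (Num.min (`|x| / k.+1%:R `^ q) 1)%:E.
have f0 k x : (0 <= f k x)%E.
  by rewrite lee_fin le_min ler01 divr_ge0 ?powR_ge0.
have mf k : measurable_fun setT (f k : borel B -> \bar R).
  apply/measurable_EFinP; apply: measurable_minr => //.
  exact: measurable_funM.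
have mfX k : measurable_fun setT (fun w => f k (X w)).
  apply/measurable_EFinP; apply: measurable_minr => //.
  exact: measurable_funM.
have mfXs k : measurable_fun setT (fun w => f k (Xs k w)).
  apply/measurable_EFinP; apply: measurable_minr => //.
  exact: measurable_funM.
pose C := 2 + (q - 1)^-1.
have C0 : 0 <= C by rewrite addr_ge0// invr_ge0 subr_ge0 ltW.
have fin : (\int[P]_w (\sum_(0 <= k <oo) f k (Xs k w)) < +oo)%E.
  rewrite integral_nneseries//.
  (* Replacing each [Xs k] by [X] under the integral yields a series in the single value [|X w|], to
     which the pointwise bound [sum_min_powR_le] applies. *)
  rewrite (_ : (\sum_(0 <= k <oo) _)%E = (\sum_(0 <= k <oo) \int[P]_w f k (X w))%E); last first.
    apply: eq_eseriesr => k _; apply: integral_same_distribution => //.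
    exact: iid.2.2.2.
  rewrite -integral_nneseries//.
  apply: (@le_lt_trans _ _ (\int[P]_w (C%:E * (`|X w| `^ p)%:E))%E); last first.
    rewrite ge0_integralZl_EFin//.
    - by rewrite lte_mul_pinfty.
    - apply/measurable_EFinP; exact: (measurableT_comp (measurable_powR p)).
  apply: ge0_le_integral => //.
  - by move=> w _; exact: nneseries_ge0.
  - have := @ge0_emeasurable_sum _ _ R setT (fun k w => f k (X w)) xpredT.
    by apply => // k _; exact: mfX.
  - apply: emeasurable_funM => //.
    apply/measurable_EFinP; exact: (measurableT_comp (measurable_powR p)).
  - move=> w _; apply: lime_le; first exact: is_cvg_nneseries.
    apply: nearW => M; rewrite sumEFin -EFinM lee_fin big_mkord.
    exact: sum_min_powR_le.
have int : P.-integrable setT (fun w => \sum_(0 <= k <oo) f k (Xs k w))%E.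
  apply/integrableP; split.
    have := @ge0_emeasurable_sum _ _ R setT (fun k w => f k (Xs k w)) xpredT.
    by apply => // k _; exact: mfXs.
  under eq_integral do rewrite gee0_abs ?nneseries_ge0//.
  exact: fin.
apply: filterS (integrable_ae measurableT int) => w /(_ I) hw.
have b0 k : 0 <= `|Xs k w| / k.+1%:R `^ q by rewrite divr_ge0 ?powR_ge0.
have [D hD] : exists D : R, forall M, \sum_(0 <= k < M) `|Xs k w| / k.+1%:R `^ q <= D.
  apply: bounded_partial_sums_of_min1 => //.
  by move: hw; rewrite ge0_fin_numE// nneseries_ge0.
apply/nneseries_ltyP => //; exists ((1 + q^-1) * D) => M.
apply: (@le_trans _ _ (\sum_(1 <= n < M.+1) term n w)).
  exact: ler_sum_nat_widen.

apply: (@le_trans _ _ (\sum_(1 <= n < M.+1)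
    n%:R^-1 * ((\sum_(k < n) `|Xs k w|) / n%:R `^ q))).
  apply: ler_sum => n _; rewrite ler_wpM2l ?invr_ge0// ler_wpM2r ?invr_ge0 ?powR_ge0//.
  exact: ler_norm_sum.
apply: le_trans (sum_weighted_partial_sums_le M q0 (fun k => normr_ge0 (Xs k w))) _.
apply: (@le_trans _ _ ((1 + q^-1) * \sum_(k < M) `|Xs k w| / k.+1%:R `^ q)).
  rewrite gerBl; apply: mulr_ge0; first by rewrite invr_ge0 ltW.
  by rewrite divr_ge0 ?powR_ge0 ?sumr_ge0.
apply: ler_wpM2l; first by rewrite addr_ge0// invr_ge0 ltW.
by rewrite -(big_mkord xpredT (fun k => `|Xs k w| / k.+1%:R `^ q)); exact: hD.
Qed.

Let integral_normXs k : (\int[P]_w `|Xs k w|%:E = \int[P]_w `|X w|%:E)%E.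
Proof.
apply: (@integral_same_distribution _ _ _ _ _ (Xs k) X (fun x => `|x|%:E)) => //.
  exact: iid.2.2.2.
exact/measurable_EFinP.
Qed.

Lemma mean_lty_of_mean_series :
  (\sum_(1 <= n <oo) ((n%:R^-1 / n%:R `^ q)%:E
     * \int[P]_w `|partial_sum Xs n w|%:E) < +oo)%E ->
  (\int[P]_w `|X w|%:E < +oo)%E.
Proof.
apply: le_lt_trans.
(* Only the term [n = 1] is kept: its weight is 1 and its partial sum is [Xs 0]. *)
have := @nneseries_lim_ge R (fun n => (n%:R^-1 / n%:R `^ q)%:E
     * \int[P]_w `|partial_sum Xs n w|%:E)%E xpredT 1 2.
rewrite big_nat1 powR1 invr1 mulr1 mul1e.
rewrite -(integral_normXs 0).
rewrite (_ : partial_sum Xs 1 = Xs 0%N); last first.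
  by apply/funext => w; rewrite /partial_sum big_ord1.
by apply => n _ _; rewrite mule_ge0 ?integral_ge0//.
Qed.

Lemma mean_series_lty_of_mean : separable B ->
  (\int[P]_w `|X w|%:E < +oo)%E ->
  (\sum_(1 <= n <oo) ((n%:R^-1 / n%:R `^ q)%:E
     * \int[P]_w `|partial_sum Xs n w|%:E) < +oo)%E.
Proof.
move=> sB hX.
have X0 : (0 <= \int[P]_w `|X w|%:E)%E by rewrite integral_ge0.
set m := fine (\int[P]_w `|X w|%:E)%E.
have mE : (\int[P]_w `|X w|%:E = m%:E)%E by rewrite fineK// ge0_fin_numE.
have m0 : 0 <= m by rewrite fine_ge0.
have ES n : (\int[P]_w `|partial_sum Xs n w|%:E <= (n%:R * m)%:E)%E.
  apply: (@le_trans _ _ (\int[P]_w (\sum_(k < n) `|Xs k w|%:E))%E).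
    apply: ge0_le_integral => //.
    - by apply/measurable_EFinP/borel_rv_norm/borel_rv_partial_sum.
    - by apply: emeasurable_sum => k; apply/measurable_EFinP.
    - by move=> w _; rewrite sumEFin lee_fin; exact: ler_norm_sum.
  rewrite ge0_integral_sum//; last by move=> k; apply/measurable_EFinP.
  under eq_bigr do rewrite integral_normXs mE.
  by rewrite sumEFin sumr_const card_ord mulr_natl.
pose C := 2 + (q - 1)^-1.
apply: (@le_lt_trans _ _ (m * C)%:E); last exact: ltry.
apply: lime_le.
  by apply: is_cvg_nneseries => n _ _; rewrite mule_ge0 ?integral_ge0//.
apply: nearW => M.
(* The term is at most [m * n^-q]. As [n^q >= 1] the minimum is [n^-q], so [sum_min_powR_le] at
   [x = 1] bounds the sum. *)
apply: (@le_trans _ _ (\sum_(1 <= n < M) (m * Num.min (1 / n%:R `^ q) 1)%:E)%E).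
  rewrite !big_nat; apply: lee_sum => n /andP[n0 _].
  apply: le_trans (lee_wpmul2l _ (ES n)) _.
    by rewrite lee_fin divr_ge0 ?powR_ge0 ?invr_ge0.
  rewrite -EFinM lee_fin.
  have n1 : 1 <= n%:R `^ q :> R.
    have e1 : 1 `^ q = 1 :> R by rewrite powR1.
    rewrite -[leLHS]e1; apply: ge0_ler_powR; rewrite ?nnegrE ?ler1n// ltW//.
  rewrite min_l; last by rewrite ler_pdivrMr ?mul1r// (lt_le_trans ltr01).
  rewrite le_eqVlt; apply/orP; left; apply/eqP; field.
  by rewrite !gt_eqF ?powR_gt0 ?ltr0n.
rewrite sumEFin lee_fin -mulr_sumr ler_wpM2l//.
rewrite big_add1 big_mkord.
by have := sum_min_powR_le M.-1 p01 ler01; rewrite powR1 mulr1.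
Qed.

End main.

Theorem theorem2p4 (R : realType) (B : completeNormedModType R)
  (d : measure_display) (Omega : measurableType d) (P : probability Omega R)
  (X : Omega -> B) (Xs : nat -> Omega -> B) (p : R) :
  separable B ->
  0 < p < 1 ->
  iid_copies P X Xs ->
  ( {ae P, forall w,
      (\sum_(1 <= n <oo)
         ((n%:R)^-1 * (`|partial_sum Xs n w| / (n%:R `^ p^-1)))%:E < +oo)%E}
    <-> (\int[P]_w ((`|X w| `^ p)%:E) < +oo)%E )
  /\
  ( (\sum_(1 <= n <oo)
       (((n%:R)^-1 / (n%:R `^ p^-1))%:E
        * \int[P]_w ((`|partial_sum Xs n w|)%:E)) < +oo)%E
    <-> (\int[P]_w ((`|X w|)%:E) < +oo)%E ).
Proof.
move=> sB p01 iid; split; split.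
- exact: moment_lty_of_series iid p01 sB.
- exact: series_lty_of_moment iid p01.
- exact: mean_lty_of_mean_series iid.
- exact: mean_series_lty_of_mean iid p01 sB.
Qed.
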